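(* The following statements are equivalent for every simple graph $G$: (i) There are disjoint nonempty subsets $A$ and $B$ of the vertex set $V(G)$ such that $G$ is a path-bipartite graph of the sets $A$ and $B$. (ii) The equality $G=G'$ holds.
   Context: Graphs are simple (no loops, no multiple edges), have a nonempty vertex set $V(G)$ and edge set $E(G)$, and may be infinite. A graph is empty if $E(G)=\varnothing$. If $G$ is nonempty, $G'$ denotes the subgraph of $G$ whose vertices are the non-isolated vertices of $G$ and for which $E(G')=E(G)$. The equality $G=G'$ is understood as: $G$ is nonempty and equals $G'$ (equivalently, $G$ has no isolated vertices); it fails if $G$ is empty. A path is a finite graph $P$ whose (distinct) vertices can be numbered $u_0,\dots,u_k$, $k\ge 1$, so that $E(P)=\{\{u_0,u_1\},\dots,\{u_{k-1},u_k\}\}$. Let $A,B$ be nonempty disjoint sets. A path $P$ is a be-path of $A$ and $B$ if $V(P)\subseteq A\cup B$ and there is exactly one edge $\{a_0,b_0\}\in E(P)$ meeting both $A$ and $B$. A graph $G$ with $A,B\subseteq V(G)$ is a path-bipartite graph of $A$ and $B$ if $G$ is the union (of vertex sets and of edge sets) of a nonempty set of be-paths of $A$ and $B$. *)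

(* Defs.v *)
From mathcomp Require Import all_boot boolp classical_sets.

Set Implicit Arguments.
Unset Strict Implicit.
Unset Printing Implicit Defensive.

Local Open Scope classical_set_scope.

(* A simple, possibly infinite graph whose vertices are taken from a type T.
   Having all graphs on one type makes a graph, its subgraphs and their unions
   comparable by plain equality; T itself is not the vertex set. *)
Record graph (T : Type) := Graph {
  vertices : set T;
  edges : set (set T);
  vertices_nonempty : vertices !=set0;
  edges_simple : forall e, edges e -> exists x y,
    [/\ vertices x, vertices y, x <> y & e = [set x; y]]
}.

Definition nonempty_graph (T : Type) (G : graph T) : Prop := edges G !=set0.

Definition nonisolated (T : Type) (G : graph T) : set T :=
  [set x | vertices G x /\ exists e, edges G e /\ e x].

Lemma nonisolated_nonempty (T : Type) (G : graph T) :
  nonempty_graph G -> nonisolated G !=set0.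
Proof.
move=> [e Ge]; have [x [y [Gx Gy _ eE]]] := edges_simple Ge.
by exists x; split=> //; exists e; split=> //; rewrite eE; left.
Qed.

Lemma nonisolated_edges (T : Type) (G : graph T) (e : set T) :
  edges G e -> exists x y,
    [/\ nonisolated G x, nonisolated G y, x <> y & e = [set x; y]].
Proof.
move=> Ge; have [x [y [Gx Gy xy eE]]] := edges_simple Ge.
exists x, y; split=> //; split=> //; exists e; split=> //; rewrite eE.
- by left.
- by right.
Qed.

(* G' is defined only when G has an edge. *)
Definition prime_graph (T : Type) (G : graph T) (hG : nonempty_graph G) :
    graph T :=
  Graph (nonisolated_nonempty hG) (@nonisolated_edges T G).

(* The equality G = G', which is false by convention when G is empty. *)
Definition eq_prime_graph (T : Type) (G : graph T) : Prop :=
  exists hG : nonempty_graph G, G = prime_graph hG.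

(* The vertices are u 0, ..., u k; the values of u beyond k are irrelevant.
   Finiteness of P follows from the numbering. *)
Definition is_path (T : Type) (P : graph T) : Prop :=
  exists (k : nat) (u : nat -> T),
    [/\ (1 <= k)%N,
        forall i j, (i <= k)%N -> (j <= k)%N -> u i = u j -> i = j,
        vertices P = [set u i | i in [set i | (i <= k)%N]] &
        edges P = [set [set u i; u i.+1] | i in [set i | (i < k)%N]]].

Definition meets (T : Type) (e A : set T) : Prop := e `&` A !=set0.

Definition be_path (T : Type) (A B : set T) (P : graph T) : Prop :=
  [/\ A !=set0, B !=set0, A `&` B = set0, is_path P &
      vertices P `<=` A `|` B /\
      exists! e, [/\ edges P e, meets e A & meets e B]].

Definition path_bipartite (T : Type) (A B : set T) (G : graph T) : Prop :=
  [/\ A `<=` vertices G, B `<=` vertices G &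
      exists F : set (graph T),
        [/\ F !=set0,
            F `<=` be_path A B,
            vertices G = \bigcup_(P in F) vertices P &
            edges G = \bigcup_(P in F) edges P]].

(* Main.v *)
Require Import Defs.
From mathcomp Require Import all_boot boolp classical_sets.

(** Given a graph without isolated vertices, let A be a maximal independent set
    and B its complement. Every vertex of B has a neighbour in A by maximality,
    so an edge between A and B is itself a be-path, an edge {b, c} inside B lies
    on a be-path a, b, c with a in A, and no edge lies inside A. Conversely, a
    path has no isolated vertex, hence neither has a union of paths. *)

Local Open Scope classical_set_scope.

Lemma graph_eq {T : Type} (G H : graph T) :
  vertices G = vertices H -> edges G = edges H -> G = H.
Proof.
case: G H => [V E nV sE] [W F nW sF] /= VW EF; subst W F.
by congr Graph; apply: Prop_irrelevance.
Qed.

(** Only this inclusion of vertex sets has content: the edge sets agree by construction, and every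
    non-isolated vertex is a vertex. *)
Lemma eq_prime_graphP {T : Type} (G : graph T) :
  eq_prime_graph G <-> nonempty_graph G /\ vertices G `<=` nonisolated G.
Proof.
split=> [[hG ->]|[hG sub]].
  split=> [//|x [Gx [e [Ge ex]]]].
  by split; [split=> //; exists e | exists e].
by exists hG; apply: graph_eq => //=; apply/seteqP; split=> [//|x []].
Qed.

Section PathGraph.
Context {T : Type} {k : nat} {u : nat -> T}.
Hypothesis k_gt0 : (1 <= k)%N.
Hypothesis u_inj :
  forall i j, (i <= k)%N -> (j <= k)%N -> u i = u j -> i = j.

Lemma path_vertices_nonempty : [set u i | i in [set i | (i <= k)%N]] !=set0.
Proof. by exists (u 0); exists 0. Qed.

Lemma path_edges_simple (e : set T) :
  [set [set u i; u i.+1] | i in [set i | (i < k)%N]] e -> exists x y,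
    [/\ [set u i | i in [set i | (i <= k)%N]] x,
        [set u i | i in [set i | (i <= k)%N]] y, x <> y & e = [set x; y]].
Proof.
move=> [i /= lt_ik <-]; exists (u i), (u i.+1); split=> //.
- by exists i => //=; exact: ltnW.
- by exists i.+1.
- by move=> /(u_inj _ _ (ltnW lt_ik) lt_ik) /n_Sn.
Qed.

Definition path_graph : graph T :=
  Graph path_vertices_nonempty path_edges_simple.

(** Only [u 0] lies outside [B], so by disjointness an edge meeting [A] must contain [u 0], and the
    first edge is the only one that does. *)
Lemma path_graph_be_path (A B : set T) :
  A `&` B = set0 -> A (u 0) -> (forall i, (0 < i <= k)%N -> B (u i)) ->
  be_path A B path_graph.
Proof.
move=> AB0 Au0 Bu; split=> //; [by exists (u 0) | by exists (u 1); exact: Bu | |].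
  by exists k, u.
split=> [_ [[|i] /= le_ik <-]|]; [by left | by right; exact: Bu |].
exists [set u 0; u 1]; split.
  split; first by exists 0.
    by exists (u 0); split=> //; left.
  by exists (u 1); split; [right | exact: Bu].
move=> _ [[[//|i] /= lt_ik <-] [x [xe Ax]] _].
have Bx : B x by case: xe => ->; apply: Bu => //=; exact: ltnW.
by have : (A `&` B) x by []; rewrite AB0.
Qed.

End PathGraph.

Definition independent {T : Type} (G : graph T) (X : set T) : Prop :=
  X `<=` vertices G /\ forall e, edges G e -> ~ e `<=` X.

(** Zorn's lemma applies because independence passes to unions of chains: the two ends of an edge
    inside the union lie in two members of the chain, and the larger of these would contain the
    edge. *)
Lemma maximal_independent {T : Type} (G : graph T) :
  exists A, independent G A /\ forall B, A `<` B -> ~ independent G B.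
Proof.
apply: (@Zorn_bigcup T (independent G)) => F indF totF; split.
  by move=> x [X FX Xx]; have [subX _] := indF _ FX; exact: subX.
move=> e Ge; have [x [y [_ _ _ eE]]] := edges_simple Ge; move=> sub.
have [X FX Xx] : (\bigcup_(X in F) X) x by apply: sub; rewrite eE; left.
have [Y FY Yy] : (\bigcup_(X in F) X) y by apply: sub; rewrite eE; right.
have [XY|YX] := totF _ _ FX FY.
  by have [_ /(_ _ Ge)] := indF _ FY; apply; rewrite eE => z [] ->; [exact: XY|].
by have [_ /(_ _ Ge)] := indF _ FX; apply; rewrite eE => z [] ->; [|exact: YX].
Qed.

Lemma maximal_independent_dominating {T : Type} (G : graph T) (A : set T) (v : T) :
  independent G A -> (forall B, A `<` B -> ~ independent G B) ->
  vertices G v -> ~ A v -> exists2 a, A a & edges G [set a; v].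
Proof.
move=> [AV indA] maxA Gv nAv; apply: contrapT => nodom.
apply: (maxA (v |` A)).
  by split=> [|sub]; [exact: subsetUr | apply: nAv; apply: sub; left].
split=> [x [->//|/AV//]|e Ge sub].
have [x [y [_ _ xy eE]]] := edges_simple Ge; subst e.
have [xv|Ax] : (v |` A) x by apply: sub; left.
  have [yv|Ay] : (v |` A) y by apply: sub; right.
    by apply: xy; rewrite xv yv.
  by apply: nodom; exists y => //; rewrite setUC -xv.
have [yv|Ay] : (v |` A) y by apply: sub; right.
  by apply: nodom; exists x => //; rewrite -yv.
by apply: (indA _ Ge) => z [] ->.
Qed.

Lemma path_bipartite_nonisolated {T : Type} (A B : set T) (G : graph T) :
  path_bipartite A B G -> nonempty_graph G /\ vertices G `<=` nonisolated G.
Proof.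
move=> [_ _ [F [[P FP] beF VE EE]]]; split.
  have [_ _ _ _ [_ [e [[Pe _ _] _]]]] := beF _ FP.
  by exists e; rewrite EE; exists P.
move=> x Gx; split=> //.
have [Q FQ Qx] : (\bigcup_(P in F) vertices P) x by rewrite -VE.
have [_ _ _ [k [u [k_gt0 _ VQ EQ]]] _] := beF _ FQ.
suff [e Qe ex] : exists2 e, edges Q e & e x.
  by exists e; split=> //; rewrite EE; exists Q.
(* The first vertex is on the first edge, which exists since [1 <= k]; every later one is on the
   edge from its predecessor, so the last vertex is no special case. *)
move: Qx; rewrite VQ EQ => -[[|i] /= le_ik <-].
  by exists [set u 0; u 1]; [exists 0 | left].
by exists [set u i; u i.+1]; [exists i | right].
Qed.

(** The edge inside [B] crosses nothing by itself; prepending [a] supplies the one crossing edge. *)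
Lemma edge_in_be_path {T : Type} (G : graph T) (A B : set T) (a b c : T) :
  A `&` B = set0 -> A `<=` vertices G -> B `<=` vertices G ->
  A a -> B b -> B c -> b <> c -> edges G [set a; b] -> edges G [set b; c] ->
  exists P, [/\ be_path A B P, vertices P `<=` vertices G,
                edges P `<=` edges G & edges P [set b; c]].
Proof.
move=> AB0 AV BV Aa Bb Bc bc Gab Gbc.
have disj x y : A x -> B y -> x <> y.
  by move=> Ax + xy; rewrite -xy => Bx; have : (A `&` B) x by []; rewrite AB0.
(* The sequence a, b, c, constant from index 2 on; injectivity is required only up to 2. *)
pose u i := if i is i'.+1 then if i' is _.+1 then c else b else a.
have u_inj i j : (i <= 2)%N -> (j <= 2)%N -> u i = u j -> i = j.
  case: i j => [|[|[|//]]] [|[|[|//]]] _ _ //= uij;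
    by [case: (disj _ _ Aa Bb) | case: (disj _ _ Aa Bc) | case: bc].
exists (path_graph u_inj); split.
- by apply: path_graph_be_path => // -[|[|]].
- by move=> _ [[|[|i]] _ <-] /=; [exact: AV | exact: BV | exact: BV].
- by move=> _ [[|[|//]] _ <-].
- by exists 1.
Qed.

Lemma cross_edge_in_be_path {T : Type} (G : graph T) (A B : set T) (a b : T) :
  A `&` B = set0 -> A `<=` vertices G -> B `<=` vertices G ->
  A a -> B b -> edges G [set a; b] ->
  exists P, [/\ be_path A B P, vertices P `<=` vertices G,
                edges P `<=` edges G & edges P [set a; b]].
Proof.
move=> AB0 AV BV Aa Bb Gab.
have ab : a <> b.
  by move=> ab; move: Bb; rewrite -ab => Ba; have : (A `&` B) a by []; rewrite AB0.
pose u i := if i is 0 then a else b.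
have u_inj i j : (i <= 1)%N -> (j <= 1)%N -> u i = u j -> i = j.
  by case: i j => [|[|//]] [|[|//]] _ _ //= uij; case: ab.
exists (path_graph u_inj); split.
- by apply: path_graph_be_path => // -[|i].
- by move=> _ [[|i] _ <-] /=; [exact: AV | exact: BV].
- by move=> _ [[|//] _ <-].
- by exists 0.
Qed.

Theorem corollary2p11 (T : Type) (G : graph T) :
  (exists A B : set T,
     [/\ A `<=` vertices G, B `<=` vertices G, A !=set0, B !=set0 &
         A `&` B = set0 /\ path_bipartite A B G])
  <-> eq_prime_graph G.
Proof.
rewrite eq_prime_graphP; split.
  by move=> [A [B [_ _ _ _ [_ /path_bipartite_nonisolated]]]].
move=> [[e Ge] noiso].
have [A [[AV indA] maxA]] := maximal_independent G.
pose B := vertices G `\` A.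
have BV : B `<=` vertices G by move=> x [].
have AB0 : A `&` B = set0 by rewrite setDIK.
have dom v : B v -> exists2 a, A a & edges G [set a; v].
  by move=> [Gv nAv]; exact: maximal_independent_dominating maxA Gv nAv.
(* If [B] were empty, the edge [e] would lie inside the independent set [A]. *)
have [b Bb] : B !=set0.
  apply: contrapT => noB; have [x [y [Gx Gy _ eE]]] := edges_simple Ge.
  apply: (indA _ Ge); rewrite eE => z ze; apply: contrapT => nAz.
  by apply: noB; exists z; split=> //; case: ze => ->.
have A0 : A !=set0 by have [a Aa _] := dom _ Bb; exists a.
have B0 : B !=set0 by exists b.
have cover f : edges G f -> exists P,
    [/\ be_path A B P, vertices P `<=` vertices G, edges P `<=` edges G &
        edges P f].
  move=> Gf; have [x [y [Gx Gy xy fE]]] := edges_simple Gf; subst f.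
  have [Ax|nAx] := pselect (A x); have [Ay|nAy] := pselect (A y).
  - by case: (indA _ Gf) => z [] ->.
  - exact: cross_edge_in_be_path.
  (* An edge is an unordered pair, so its ends are swapped to put the one in [A] first. *)
  - by rewrite setUC in Gf *; exact: cross_edge_in_be_path.
  - have [a Aa Gax] := dom x (conj Gx nAx).
    exact: edge_in_be_path Aa _ _ xy Gax Gf.
exists A, B; split=> //; split=> //; split=> //.
(* Taking all be-paths contained in [G] makes the unions lie in [G] at once; [cover] gives the
   converse for edges, and for vertices because each is on an edge. *)
exists [set P | [/\ be_path A B P, vertices P `<=` vertices G &
                   edges P `<=` edges G]]; split.
- by have [P [beP VP EP _]] := cover _ Ge; exists P.
- by move=> P [].
- apply/seteqP; split=> [x /noiso [_ [f [Gf fx]]]|x [P [_ VP _] /VP//]].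
  have [P [beP VP EP Pf]] := cover _ Gf; exists P => //.
  (* Applied to [f] as an edge of [P], so that its ends are vertices of [P] and not merely of
     [G]. *)
  have [y [z [Py Pz _ fE]]] := edges_simple Pf.
  by move: fx; rewrite fE => -[] ->.
- apply/seteqP; split=> [f Gf|f [P [_ _ EP] /EP//]].
  by have [P [beP VP EP Pf]] := cover _ Gf; exists P.
Qed.
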